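(* Let $n\ge 2$, let $F\subset\mathbb{R}^n$ be a compact convex set with $\mathbf{0}$ in its interior, and let $\xi\in\partial F$. Assume that there are $\delta>0$ and $f:\mathbb{R}^n\to\mathbb{R}$ of class $C^2$ on $\xi+\delta\mathbf{B}$ such that $F\subset\{x\in\mathbb{R}^n: f(x)\le 0\}$, $\langle \xi,\nabla f(\xi)\rangle>0$, and such that, for $x\in\xi+\delta\mathbf{B}$, we have $x\in\partial F$ if and only if $f(x)=0$. Then $$\hat\varkappa_F(\xi,u(\xi))=\frac{1}{2\|\nabla f(\xi)\|\,\|u(\xi)\|^2}\,\langle\nabla^2 f(\xi)u(\xi),u(\xi)\rangle$$ for any $u(\xi)\in\mathbf{T}_F(\xi)\setminus\{\mathbf 0\}$.
   Context: $\langle\cdot,\cdot\rangle$ and $\|\cdot\|$ are the usual inner product and norm of $\mathbb{R}^n$, $\mathbf{B}$ is the open unit ball, $f_{x_k}=\partial f/\partial x_k$, and $\nabla^2 f(\xi)$ is the Hessian matrix. Let $I=\{1,\dots,n\}$ and let $i\in I$ be the first index with $f_{x_i}(\xi)\ne0$. All points $\eta$ below are taken close enough to $\xi$ that $\langle\eta,\nabla f(\eta)\rangle>0$ and $f_{x_i}(\eta)\ne0$. For $\eta\in\partial F$ near $\xi$: - $\eta^*:=\frac{1}{\langle\eta,\nabla f(\eta)\rangle}\nabla f(\eta)$ (in particular $\xi^*=\frac{1}{\langle\xi,\nabla f(\xi)\rangle}\nabla f(\xi)$). - $\mathbf{T}_F(\eta):=\{v\in\mathbb{R}^n:\langle v,\nabla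 f(\eta)\rangle=0\}$ is the tangent hyperplane. - For $j\in I\setminus\{i\}$, $u^j(\eta)$ is the vector with $1$ in the $j$th coordinate, $-\frac{f_{x_j}(\eta)}{f_{x_i}(\eta)}$ in the $i$th coordinate and $0$ in the others; these vectors span $\mathbf{T}_F(\eta)$. - Given $u(\xi)=\sum_{j\ne i}\alpha_j u^j(\xi)\in\mathbf{T}_F(\xi)\setminus\{\mathbf0\}$, put $u(\eta):=\sum_{j\neq i}\alpha_j u^j(\eta)\in\mathbf{T}_F(\eta)$ (same $\alpha_j$). - For $u\in\mathbf{T}_F(\eta)\setminus\{\mathbf 0\}$, $P(\eta,u):=\eta+\operatorname{span}\{\nabla f(\eta),u\}$. - For $r>0$, $\widehat{\mathfrak C}_F(r,\eta,u):=\inf\{\langle\eta-y,\eta^*\rangle: y\in F\cap P(\eta,u),\ \|\eta-y\|\ge r\}$ (with $\inf\emptyset=+\infty$). Finally $$\hat\gamma_F(\xi,u(\xi)):=\liminf_{(r,\eta)\to(0^+,\xi),\ \eta\in\partial F}\frac{\widehat{\mathfrak C}_F(r,\eta,u(\eta))}{r^2},\qquad \hat\varkappa_F(\xi,u(\xi)):=\frac{1}{\|\xi^*\|}\hat\gamma_F(\xi,u(\xi)).$$ *)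

(* Defs.v *)
From HB Require Import structures.
From mathcomp Require Import all_boot all_order all_algebra.
From mathcomp Require Import all_classical all_reals all_analysis.
Set Implicit Arguments.
Unset Strict Implicit.
Unset Printing Implicit Defensive.
Import Order.TTheory GRing.Theory Num.Theory.
Import numFieldNormedType.Exports.
Local Open Scope classical_set_scope.
Local Open Scope ring_scope.

Definition dotv (R : realType) (n : nat) (u v : 'rV[R]_n) : R :=
  \sum_(k < n) u 0 k * v 0 k.

(* The library norm `|u| on 'rV[R]_n is the sup norm, so the Euclidean norm and
   its balls are defined separately; both norms induce the library topology. *)
Definition enorm (R : realType) (n : nat) (u : 'rV[R]_n) : R :=
  Num.sqrt (dotv u u).

Definition eball (R : realType) (n : nat) (x : 'rV[R]_n) (r : R) :
    set 'rV[R]_n :=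
  [set y | enorm (y - x) < r].

Definition boundary (T : topologicalType) (A : set T) : set T :=
  closure A `\` A°.

Definition partial (R : realType) (n : nat) (k : 'I_n) (f : 'rV[R]_n -> R) :
    'rV[R]_n -> R :=
  fun x => 'D_(delta_mx 0 k) (f : 'rV[R]_n -> R^o) x.

Definition gradient (R : realType) (n : nat) (f : 'rV[R]_n -> R)
    (x : 'rV[R]_n) : 'rV[R]_n :=
  \row_k partial k f x.

Definition hessian (R : realType) (n : nat) (f : 'rV[R]_n -> R)
    (x : 'rV[R]_n) : 'M[R]_n :=
  \matrix_(j, k) partial j (partial k f) x.

(* Classes C^1 and C^2 on U; meant for open U, since derivability and
   continuity are required in the ambient space at each point of U. *)
Definition C1_on (R : realType) (n : nat) (U : set 'rV[R]_n)
    (f : 'rV[R]_n -> R) : Prop :=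
  forall x, U x -> forall k : 'I_n,
    derivable (f : 'rV[R]_n -> R^o) x (delta_mx 0 k) /\
    {for x, continuous (partial k f)}.

Definition C2_on (R : realType) (n : nat) (U : set 'rV[R]_n)
    (f : 'rV[R]_n -> R) : Prop :=
  C1_on U f /\ forall k : 'I_n, C1_on U (partial k f).

Definition first_nonzero_partial (R : realType) (n : nat)
    (f : 'rV[R]_n -> R) (x : 'rV[R]_n) (i : 'I_n) : Prop :=
  partial i f x != 0 /\ forall j : 'I_n, (j < i)%N -> partial j f x = 0.

(* [dual_pt f eta] is eta^*. *)
Definition dual_pt (R : realType) (n : nat) (f : 'rV[R]_n -> R)
    (eta : 'rV[R]_n) : 'rV[R]_n :=
  (dotv eta (gradient f eta))^-1 *: gradient f eta.

Definition tangent_space (R : realType) (n : nat) (f : 'rV[R]_n -> R)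
    (eta : 'rV[R]_n) : set 'rV[R]_n :=
  [set v | dotv v (gradient f eta) = 0].

(* [tangent_vec f i j eta] is u^j(eta), for j != i. *)
Definition tangent_vec (R : realType) (n : nat) (f : 'rV[R]_n -> R)
    (i j : 'I_n) (eta : 'rV[R]_n) : 'rV[R]_n :=
  \row_k (if k == j then 1
          else if k == i then - (partial j f eta / partial i f eta)
          else 0).

(* The field eta |-> u(eta) with fixed coefficients alpha; alpha i is unused. *)
Definition tangent_field (R : realType) (n : nat) (f : 'rV[R]_n -> R)
    (i : 'I_n) (alpha : 'I_n -> R) (eta : 'rV[R]_n) : 'rV[R]_n :=
  \sum_(j < n | j != i) alpha j *: tangent_vec f i j eta.

Definition normal_plane (R : realType) (n : nat) (f : 'rV[R]_n -> R)
    (eta u : 'rV[R]_n) : set 'rV[R]_n :=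
  [set y | exists a b : R, y = eta + (a *: gradient f eta + b *: u)].

Definition chat (R : realType) (n : nat) (F : set 'rV[R]_n)
    (f : 'rV[R]_n -> R) (r : R) (eta u : 'rV[R]_n) : \bar R :=
  ereal_inf [set (dotv (eta - y) (dual_pt f eta))%:E
            | y in F `&` normal_plane f eta u `&`
                   [set y | r <= enorm (eta - y)]].

(* gamma-hat and kappa-hat at xi take the whole field u(.), because the liminf
   involves u(eta) for boundary points eta near xi (eta = xi included). *)
Definition gammahat (R : realType) (n : nat) (F : set 'rV[R]_n)
    (f : 'rV[R]_n -> R) (xi : 'rV[R]_n) (u : 'rV[R]_n -> 'rV[R]_n) : \bar R :=
  limf_einf
    (fun p : R * 'rV[R]_n =>
       (chat F f p.1 p.2 (u p.2) / (p.1 ^+ 2)%:E)%E)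
    (filter_prod (0^'+) (within (boundary F) (nbhs xi))).

Definition kappahat (R : realType) (n : nat) (F : set 'rV[R]_n)
    (f : 'rV[R]_n -> R) (xi : 'rV[R]_n) (u : 'rV[R]_n -> 'rV[R]_n) : \bar R :=
  ((1 / enorm (dual_pt f xi))%:E * gammahat F f xi u)%E.

Lemma tangent_fieldE (R : realType) (n : nat) (f : 'rV[R]_n -> R)
    (i : 'I_n) (alpha : 'I_n -> R) (eta : 'rV[R]_n) (k : 'I_n) :
  k != i -> tangent_field f i alpha eta 0 k = alpha k.
Proof.
move=> ki; rewrite /tangent_field summxE.
have E j : (alpha j *: tangent_vec f i j eta) 0 k = if j == k then alpha j else 0.
  rewrite mxE [tangent_vec f i j eta 0 k]mxE eq_sym (negbTE ki).
  by case: (j == k); rewrite ?mulr1 ?mulr0.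
rewrite (eq_bigr _ (fun j _ => E j)) -big_mkcondr /=.
rewrite (eq_bigl (pred1 k)) ?big_pred1_eq // => j /=.
by have [->|] := eqVneq j k; rewrite ?andbT ?andbF.
Qed.

(* Every tangent vector is the value at eta of such a field; by
   [tangent_fieldE] the coefficients alpha j, j != i, are unique. *)
Lemma tangent_field_span (R : realType) (n : nat) (f : 'rV[R]_n -> R)
    (i : 'I_n) (eta u : 'rV[R]_n) :
  partial i f eta != 0 -> tangent_space f eta u ->
  u = tangent_field f i (fun j => u 0 j) eta.
Proof.
move=> fi0 Tu; apply/rowP => k.
have [->|ki] := eqVneq k i; last by rewrite tangent_fieldE.
have G j : gradient f eta 0 j = partial j f eta by rewrite mxE.
have E j : j != i -> (u 0 j *: tangent_vec f i j eta) 0 i * partial i f eta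
    = - (u 0 j * partial j f eta).
  move=> ji; rewrite mxE [tangent_vec f i j eta 0 i]mxE eq_sym (negbTE ji) eqxx.
  by rewrite -mulrA mulNr (divfK fi0) mulrN.
have S : partial i f eta * u 0 i
    + \sum_(j < n | j != i) u 0 j * partial j f eta = 0.
  rewrite mulrC -[RHS]Tu /dotv [RHS](bigD1 i erefl) G.
  by congr (_ + _); apply: eq_bigr => j _; rewrite G.
apply: (mulIf fi0); rewrite /tangent_field summxE mulr_suml (eq_bigr _ E) sumrN.
by apply/eqP; rewrite -addr_eq0 mulrC S.
Qed.

(* Main.v *)
Require Import Defs.
From HB Require Import structures.
From mathcomp Require Import all_boot all_order all_algebra.
From mathcomp Require Import all_classical all_reals all_analysis.
From mathcomp Require Import ring lra.
Set Implicit Arguments.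
Unset Strict Implicit.
Unset Printing Implicit Defensive.
Import Order.TTheory GRing.Theory Num.Theory.
Import numFieldNormedType.Exports.
Local Open Scope classical_set_scope.
Local Open Scope ring_scope.

(** Write g for the gradient of f, H for the Hessian of f at xi, and put L :=
    <H u, u> / (2 |u|^2). Since eta^* = g(eta) / <eta, g(eta)> and |xi^*| =
    |g(xi)| / <xi, g(xi)>, the curvature is 1 / |g(xi)| times the lower limit
    of h / r^2, where h is the infimum of the height <eta - y, g(eta)>
    over the points y of F in the plane eta + span(g(eta), u(eta)) at distance
    at least r from eta. So the claim is that this lower limit is L.

    At least L ([height_lower]). As F is convex and f <= 0 = f(eta) on F,
    heights are nonnegative, hence they do not increase when y slides along
    the segment towards eta, and y may be taken at distance exactly r. With v
    = y - eta = a g(eta) + b u(eta), the second order Taylor formula, uniform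
    in eta near xi ([quadratic_approx]), turns f(y) <= 0 into height >= <H v,
    v> / 2 - o(r^2). Write <H v, v> = p(v) + 2 L |v|^2: the form p vanishes at
    u(xi), so p(v) is o(r^2) unless a is of order r; but if the height -a |g|^2
    is below L r^2 then a = O(r^2) and p(v) = o(r^2).

    At most L ([height_upper]). A lower limit is bounded by its values along
    one sequence, and eta = xi suffices. Take y = xi + (r / |u|) u - a g(xi)
    with a chosen to make the height equal to (L + e) r^2. Its distance to xi
    is at least r by orthogonality, and Taylor gives f(y) = - e r^2 + o(r^2) <
    0. It remains to know that f < 0 forces membership in F near xi
    ([sublevel_subset_near]): moving from y in the direction -xi, f decreases,
    so the path never meets the boundary, where f = 0, while it ends in F
    because 0 is interior to F.

    Only continuous partial derivatives of f are given; [increment_bound]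
    changes one coordinate at a time to obtain derivatives along arbitrary
    lines. *)

(** * Mean value and Taylor formulas on the unit interval *)

(** Subtracting from phi its first order expansion and the multiple of t^2
    that makes the difference vanish at 1, Rolle's theorem applies twice. *)
Lemma taylor2_lagrange (R : realType) (phi phi1 phi2 : R -> R) :
    (forall t : R, 0 <= t <= 1 -> is_derive t 1 phi (phi1 t)) ->
    (forall t : R, 0 <= t <= 1 -> is_derive t 1 phi1 (phi2 t)) ->
  exists2 c, 0 <= c <= 1 & phi 1 = phi 0 + phi1 0 + phi2 c / 2.
Proof.
move=> d1 d2; pose K := phi 1 - phi 0 - phi1 0.
pose g (t : R) : R := phi t - phi1 0 * t - K * t ^+ 2.
pose g1 (t : R) : R := phi1 t - phi1 0 - K * (2 * t).
have dg (t : R) : 0 <= t <= 1 -> is_derive t 1 g (g1 t).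
  move=> /d1 dt; rewrite /g /g1.
  apply: is_derive_eq.
  by rewrite /= /GRing.scale /=; ring.
have dg1 (t : R) : 0 <= t <= 1 -> is_derive t 1 g1 (phi2 t - K * 2).
  move=> /d2 dt; rewrite /g1.
  apply: is_derive_eq.
  by rewrite /= /GRing.scale /=; ring.
have cont (h dh : R -> R) b : b <= 1 ->
    (forall t : R, 0 <= t <= 1 -> is_derive t 1 h (dh t)) ->
    {within `[0, b], continuous h}.
  move=> b1 dh_; apply: derivable_within_continuous => t.
  rewrite in_itv /= => /andP[t0 tb].
  by have /dh_ : 0 <= t <= 1 by rewrite t0 (le_trans tb b1).
have [c1 c1I dc1] : exists2 c : R, c \in `]0, 1[%R & is_derive c 1 g 0.
  apply: Rolle => //.
  - move=> t; rewrite in_itv /= => /andP[t0 t1].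
    by have /dg : 0 <= t <= 1 by rewrite !ltW.
  - exact: cont dg.
  - by rewrite /g /K; ring.
move: c1I; rewrite in_itv /= => /andP[c10 c11].
have g1c1 : g1 c1 = 0.
  have c1I : 0 <= c1 <= 1 by rewrite !ltW.
  have dgc1 := dg _ c1I; rewrite -(@derive_val _ _ _ _ _ _ _ dgc1).
  by rewrite (@derive_val _ _ _ _ _ _ _ dc1).
have [c cI dc] : exists2 c : R, c \in `]0, c1[%R & is_derive c 1 g1 0.
  apply: Rolle => //.
  - move=> t; rewrite in_itv /= => /andP[t0 t1].
    by have /dg1 : 0 <= t <= 1 by rewrite !ltW // (lt_trans t1 c11).
  - exact: (cont _ _ _ (ltW c11) dg1).
  - by rewrite g1c1 /g1; ring.
move: cI; rewrite in_itv /= => /andP[c0 cc1].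
have cI : 0 <= c <= 1 by rewrite !ltW // (lt_trans cc1 c11).
exists c => //.
have := dg1 _ cI => dgc.
have : phi2 c - K * 2 = 0.
  by rewrite -(@derive_val _ _ _ _ _ _ _ dgc) (@derive_val _ _ _ _ _ _ _ dc).
by rewrite /K => E; lra.
Qed.

Lemma mvt_unit_interval (R : realType) (phi phi1 : R -> R) :
    (forall t : R, 0 <= t <= 1 -> is_derive t 1 phi (phi1 t)) ->
  exists2 c, 0 <= c <= 1 & phi 1 - phi 0 = phi1 c.
Proof.
move=> d1.
have [||c cI ->] := @MVT_segment R phi phi1 0 1 ler01.
- by move=> t; rewrite in_itv /= => /andP[t0 t1]; apply: d1; rewrite !ltW.
- apply: derivable_within_continuous => t; rewrite in_itv /= => tI.
  by have := d1 _ tI.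
- by exists c; [move: cI; rewrite in_itv | rewrite subr0 mulr1].
Qed.

Section euclidean.
Variables (R : realType) (n : nat).
Implicit Types (M N : 'M[R]_n) (f : 'rV[R]_n -> R).
Implicit Types (u v w x y z xi : 'rV[R]_n) (F U : set 'rV[R]_n).

(** * Inner product, Euclidean norm and bilinear forms *)

Definition bil M u v : R := \sum_j \sum_k M j k * u 0 j * v 0 k.

Lemma bilDl M u1 u2 v : bil M (u1 + u2) v = bil M u1 v + bil M u2 v.
Proof.
rewrite -big_split; apply: eq_bigr => j _; rewrite -big_split.
by apply: eq_bigr => k _; rewrite mxE mulrDr mulrDl.
Qed.

Lemma bilDr M u v1 v2 : bil M u (v1 + v2) = bil M u v1 + bil M u v2.
Proof.
rewrite -big_split; apply: eq_bigr => j _; rewrite -big_split.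
by apply: eq_bigr => k _; rewrite mxE mulrDr.
Qed.

Lemma bilZl M a u v : bil M (a *: u) v = a * bil M u v.
Proof.
rewrite mulr_sumr; apply: eq_bigr => j _; rewrite mulr_sumr.
by apply: eq_bigr => k _; rewrite mxE; ring.
Qed.

Lemma bilZr M a u v : bil M u (a *: v) = a * bil M u v.
Proof.
rewrite mulr_sumr; apply: eq_bigr => j _; rewrite mulr_sumr.
by apply: eq_bigr => k _; rewrite mxE; ring.
Qed.

Lemma bilB M N u v : bil (M - N) u v = bil M u v - bil N u v.
Proof.
rewrite -sumrB; apply: eq_bigr => j _; rewrite -sumrB; apply: eq_bigr => k _.
by rewrite !mxE; ring.
Qed.

Lemma bil_scalar c u v : bil c%:M u v = c * dotv u v.
Proof.
rewrite mulr_sumr; apply: eq_bigr => j _; rewrite (bigD1 j) //= big1 => [|k kj].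
  by rewrite !mxE eqxx mulr1n addr0 mulrA.
by rewrite !mxE eq_sym (negbTE kj) mulr0n !mul0r.
Qed.

(** With c = 2 L the shifted form vanishes at u, which isolates the
    contribution of the curvature from the error terms. *)
Lemma bil_shift M c u : bil M u u = bil (M - c%:M) u u + c * dotv u u.
Proof. by rewrite bilB bil_scalar subrK. Qed.

Lemma dotv_bil M u : dotv (M *m u^T)^T u = bil M u u.
Proof.
apply: eq_bigr => j _; rewrite !mxE mulr_suml; apply: eq_bigr => k _.
by rewrite !mxE; ring.
Qed.

Lemma dotvC u v : dotv u v = dotv v u.
Proof. by apply: eq_bigr => k _; rewrite mulrC. Qed.

Lemma dotvDl u v w : dotv (u + v) w = dotv u w + dotv v w.
Proof. by rewrite -big_split; apply: eq_bigr => k _; rewrite mxE mulrDl. Qed.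

Lemma dotvDr u v w : dotv w (u + v) = dotv w u + dotv w v.
Proof. by rewrite dotvC dotvDl !(dotvC w). Qed.

Lemma dotvZl a u v : dotv (a *: u) v = a * dotv u v.
Proof. by rewrite mulr_sumr; apply: eq_bigr => k _; rewrite mxE mulrA. Qed.

Lemma dotvZr a u v : dotv u (a *: v) = a * dotv u v.
Proof. by rewrite dotvC dotvZl dotvC. Qed.

Lemma dotvNl u v : dotv (- u) v = - dotv u v.
Proof. by rewrite -scaleN1r dotvZl mulN1r. Qed.

Lemma dotvv_ge0 u : 0 <= dotv u u.
Proof. by apply: sumr_ge0 => k _; rewrite -expr2 sqr_ge0. Qed.

Lemma dotvv_gt0 u : u != 0 -> 0 < dotv u u.
Proof.
move=> u0; rewrite lt_neqAle dotvv_ge0 andbT eq_sym.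
apply: contra u0 => /eqP d0.
apply/eqP/rowP => k; rewrite mxE; apply/eqP; rewrite -sqrf_eq0 expr2.
apply/eqP; apply: (psumr_eq0P _ d0) => // j _.
by rewrite -expr2 sqr_ge0.
Qed.

Lemma dotv_gt0_neq0 u v : 0 < dotv u v -> v != 0.
Proof.
apply: contraL => /eqP ->; rewrite -leNgt.
by rewrite -(scale0r u) dotvZr mul0r.
Qed.

Lemma sqr_enorm u : enorm u ^+ 2 = dotv u u.
Proof. by rewrite sqr_sqrtr // dotvv_ge0. Qed.

Lemma enorm_gt0 u : u != 0 -> 0 < enorm u.
Proof. by move=> /dotvv_gt0; rewrite sqrtr_gt0. Qed.

Lemma enormZ a u : enorm (a *: u) = `|a| * enorm u.
Proof.
rewrite /enorm dotvZl dotvZr mulrA -expr2.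
by rewrite sqrtrM ?sqr_ge0 // sqrtr_sqr.
Qed.

Lemma enormN u : enorm (- u) = enorm u.
Proof. by rewrite -scaleN1r enormZ normrN1 mul1r. Qed.

(** The topology comes from the sup norm, distances from the Euclidean one. *)
Lemma norm_le_enorm u : `|u| <= enorm u.
Proof.
rewrite [leLHS]/Num.Def.normr /= mx_normrE.
apply: bigmax_le => [|[i j] _ /=]; first exact: sqrtr_ge0.
rewrite ord1 -sqrtr_sqr ler_wsqrtr // /dotv (bigD1 j) //= expr2 lerDl.
by apply: sumr_ge0 => k _; rewrite -expr2 sqr_ge0.
Qed.

(** Entrywise bound, from 2 |a b| <= a^2 + b^2. *)
Lemma bil_le M e u : (forall j k, `|M j k| <= e) ->
  `|bil M u u| <= e * n%:R * dotv u u.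
Proof.
move=> Me; apply: (@le_trans _ _ (\sum_(j < n) \sum_(k < n)
    e * ((u 0 j ^+ 2 + u 0 k ^+ 2) / 2))).
  apply: (le_trans (ler_norm_sum _ _ _)); apply: ler_sum => j _.
  apply: (le_trans (ler_norm_sum _ _ _)); apply: ler_sum => k _.
  rewrite -mulrA normrM ler_pM // normrM -(real_normK (num_real (u 0 j))).
  rewrite -(real_normK (num_real (u 0 k))).
  have := sqr_ge0 (`|u 0 j| - `|u 0 k|); nra.
suff -> : \sum_(j < n) \sum_(k < n) e * ((u 0 j ^+ 2 + u 0 k ^+ 2) / 2)
    = e * n%:R * dotv u u by [].
under eq_bigr do rewrite -mulr_sumr -mulr_suml big_split /= sumr_const card_ord.
rewrite -mulr_sumr -mulr_suml big_split /= sumr_const card_ord.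
under eq_bigr do rewrite -mulr_natr.
rewrite -mulr_suml -mulr_natr.
have -> : dotv u u = \sum_(i < n) u 0 i ^+ 2.
  by apply: eq_bigr => i _; rewrite expr2.
by field.
Qed.

Lemma cvg_dotv (T : Type) (F : set_system T) {FF : Filter F}
    (g h : T -> 'rV[R]_n) (a b : 'rV[R]_n) :
  (forall k, g x 0 k @[x --> F] --> a 0 k) ->
  (forall k, h x 0 k @[x --> F] --> b 0 k) ->
  dotv (g x) (h x) @[x --> F] --> dotv a b.
Proof.
move=> ga hb; apply: (cvg_big add_continuous) => k _.
by apply: cvgM.
Qed.

Lemma cvg_bil M (T : Type) (F : set_system T) {FF : Filter F}
    (g h : T -> 'rV[R]_n) (a b : 'rV[R]_n) :
  (forall k, g x 0 k @[x --> F] --> a 0 k) ->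
  (forall k, h x 0 k @[x --> F] --> b 0 k) ->
  bil M (g x) (h x) @[x --> F] --> bil M a b.
Proof.
move=> ga hb; apply: (cvg_big add_continuous) => j _.
apply: (cvg_big add_continuous) => k _.
by apply: cvgM => //; apply: cvgM => //; exact: cvg_cst.
Qed.

Lemma cvg_coordB (x y : 'rV[R]_n) (k : 'I_n) :
  (z - x) 0 k @[z --> y] --> (y - x) 0 k.
Proof.
have E (z : 'rV[R]_n) : (z - x) 0 k = z 0 k - x 0 k by rewrite !mxE.
under eq_fun do rewrite E.
rewrite E; apply: (@cvgB _ _ _ (nbhs y)); first exact: coord_continuous.
exact: cvg_cst.
Qed.

Lemma eball_open x r : 0 < r -> open (eball x r : set 'rV[R]_n).
Proof.
move=> r0; pose h (y : 'rV[R]_n) : R := dotv (y - x) (y - x).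
have -> : eball x r = h @^-1` [set s | s < r ^+ 2].
  apply/funext => y; apply/propext; rewrite /eball /= /enorm.
  have {1}-> : r = Num.sqrt (r ^+ 2) by rewrite sqrtr_sqr ger0_norm // ltW.
  by rewrite ltr_sqrt // exprn_gt0.
have ch : forall y : 'rV[R]_n, h z @[z --> y] --> h y := fun y : 'rV[R]_n =>
  cvg_dotv (@cvg_coordB x y) (@cvg_coordB x y).
by apply: open_comp; [move=> y _; exact: ch|exact: open_lt].
Qed.

(** * Functions of class C1 and C2 along lines *)

Lemma coord_le_norm v k : `|v 0 k| <= `|v|.
Proof.
rewrite [leRHS]/Num.Def.normr /= mx_normrE.
exact: (le_bigmax _ (fun ij => `|v ij.1 ij.2|) (0, k)).
Qed.

Lemma is_derive_line f x v t df :
  is_derive (x + t *: v) v (f : 'rV[R]_n -> R^o) df ->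
  is_derive t 1 (fun s => f (x + s *: v)) df.
Proof.
move=> [dv Ev].
have E : (fun h : R => h^-1 *:
      (((fun s => f (x + s *: v)) \o shift t) (h *: 1) - f (x + t *: v))) =
    (fun h : R => h^-1 *:
      (((f : 'rV[R]_n -> R^o) \o shift (x + t *: v)) (h *: v) -
        f (x + t *: v))).
  apply/funext => h /=; congr (_ *: (f _ - _)).
  by rewrite [h *: 1]mulr1 scalerDl addrCA.
by split; [rewrite /derivable E|rewrite -Ev /derive E].
Qed.

Lemma partial_increment f z (s c e : R) (k : 'I_n) :
  (forall t : R, 0 <= t <= 1 ->
    derivable (f : 'rV[R]_n -> R^o) (z + (t * s) *: delta_mx 0 k) (delta_mx 0 k)
    /\ `|partial k f (z + (t * s) *: delta_mx 0 k) - c| <= e) ->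
  `|f (z + s *: delta_mx 0 k) - f z - s * c| <= e * `|s|.
Proof.
move=> H.
pose phi t := f (z + (t * s) *: delta_mx 0 k).
have dphi (t : R) : 0 <= t <= 1 ->
    is_derive t 1 phi (s * partial k f (z + (t * s) *: delta_mx 0 k)).
  move=> /H [dt _].
  have dg : is_derive (t * s) 1 (fun r => f (z + r *: delta_mx 0 k))
    (partial k f (z + (t * s) *: delta_mx 0 k)).
    by apply: is_derive_line; exact: derivableP.
  have ds : is_derive t 1 (fun r => r * s) s.
    by apply: is_derive_eq; rewrite /= /GRing.scale /=; ring.
  rewrite mulrC.
  exact: (@is_derive1_comp _ (fun r => f (z + r *: delta_mx 0 k))
    (fun r => r * s) _ _ _ dg ds).
have [c0 c0I] := mvt_unit_interval dphi.
rewrite /phi mul1r mul0r scale0r addr0 => ->.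
by rewrite -mulrBr normrM mulrC ler_wpM2r //; have [] := H _ c0I.
Qed.

(** The coordinates of x are changed to those of x + w one at a time; every
    intermediate point stays in the box spanned by x and x + w, where the
    partial derivatives are within e of c. *)
Lemma increment_bound f x w (c : 'I_n -> R) (e : R) :
  (forall y : 'rV[R]_n, (forall k, `|y 0 k - x 0 k| <= `|w 0 k|) -> forall k,
    derivable (f : 'rV[R]_n -> R^o) y (delta_mx 0 k) /\
    `|partial k f y - c k| <= e) ->
  `|f (x + w) - f x - \sum_k w 0 k * c k| <= e * \sum_k `|w 0 k|.
Proof.
move=> H; pose wt m : 'rV[R]_n := \row_k (if (k < m)%N then w 0 k else 0).
have main m : (m <= n)%N ->
    `|f (x + wt m) - f x - \sum_(k < n | (k < m)%N) w 0 k * c k|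
    <= e * \sum_(k < n | (k < m)%N) `|w 0 k|.
  elim: m => [|m IH] mn.
    rewrite !big_pred0 // mulr0 subr0.
    suff -> : wt 0%N = 0 by rewrite addr0 subrr normr0.
    by apply/rowP => k; rewrite !mxE.
  pose i := Ordinal mn.
  have wtS : wt m.+1 = wt m + w 0 i *: delta_mx 0 i.
    apply/rowP => k; rewrite !mxE eqxx /= ltnS leq_eqVlt.
    have -> : (k == m :> nat) = (k == i) by [].
    case: (eqVneq k i) => [->|_] /=; first by rewrite ltnn mulr1 add0r.
    by rewrite mulr0 addr0.
  have sumS (h : 'I_n -> R) : \sum_(k < n | (k < m.+1)%N) h k =
      h i + \sum_(k < n | (k < m)%N) h k.
    rewrite (bigD1 i) //=; congr (_ + _); apply: eq_bigl => k.
    by rewrite ltnS ltn_neqAle andbC.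
  rewrite !sumS wtS mulrDr addrA.
  have := IH (ltnW mn).
  set S1 := \sum_(k < n | _) _; set S2 := \sum_(k < n | _) _.
  have : `|f (x + wt m + w 0 i *: delta_mx 0 i) - f (x + wt m) - w 0 i * c i|
      <= e * `|w 0 i|.
    apply: partial_increment => t /andP[t0 t1]; apply: H => k.
    have cancel (a b d : R) : a + b + d - a = b + d by ring.
    rewrite !mxE eqxx /= cancel.
    case: (eqVneq k i) => [->|_] /=.
      by rewrite ltnn mulr1 add0r normrM ger0_norm // ler_piMl.
    by rewrite mulr0 addr0; case: ifP; rewrite ?normr0.
  rewrite !ler_norml; move: (f _) (f _) (f x) => a b d.
  by move=> /andP[? ?] /andP[? ?]; apply/andP; split; lra.
have -> : w = wt n by apply/rowP => k; rewrite !mxE ltn_ord.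
have wtn : wt n = w by apply/rowP => k; rewrite !mxE ltn_ord.
have := main n (leqnn n); rewrite wtn.
under eq_bigl do rewrite ltn_ord.
by under [X in _ * X]eq_bigl do rewrite ltn_ord.
Qed.

(** Continuity of the partial derivatives at x makes the e of
    [increment_bound] as small as desired. *)
Lemma C1_is_derive U f x v : open U -> C1_on U f -> U x ->
  is_derive x v (f : 'rV[R]_n -> R^o) (dotv v (gradient f x)).
Proof.
move=> oU fC1 Ux; set l := dotv _ _.
suff cv : (fun h : R => h^-1 *:
    (((f : 'rV[R]_n -> R^o) \o shift x) (h *: v) - f x)) @ 0^' --> (l : R^o).
  by split; [apply/cvg_ex; exists l|exact: cvg_lim cv].
apply/cvgrPdist_le => /= e e0.
pose S := \sum_k `|v 0 k|.
have S0 : 0 <= S by exact: sumr_ge0.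
(* The summand 1 keeps the denominator positive when v = 0. *)
pose e' := e / (1 + S).
have e'0 : 0 < e' by rewrite divr_gt0 // ltr_pwDl.
have : \forall y \near x,
    U y /\ forall k, `|partial k f x - partial k f y| <= e'.
  have nU : \forall y \near x, U y by exact: open_nbhs_nbhs.
  have np : \forall y \near x,
      forall k, `|partial k f x - partial k f y| <= e'.
    apply: (@filter_forall _ 'I_n
      (fun k y => `|partial k f x - partial k f y| <= e') (nbhs x) _) => k.
    have [_ ck] := fC1 _ Ux k.
    by move/cvgrPdist_le : ck; apply.
  by apply: filterS2 nU np.
move=> /nbhs_ballP[/= d d0 dx].
near=> h.
have h0 : h != 0 by near: h; exact: nbhs_dnbhs_neq.
have hd : `|h| * (1 + `|v|) < d.
  rewrite -ltr_pdivlMr ?ltr_pwDl //.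
  by near: h; apply: dnbhs0_lt; rewrite divr_gt0 // ltr_pwDl.
have : `|f (x + h *: v) - f x - \sum_k (h *: v) 0 k * partial k f x|
   <= e' * \sum_k `|(h *: v) 0 k|.
  apply: increment_bound => y yx k.
  have /dx[Uy py] : ball x d y.
    split=> // i j; rewrite ord1 /ball /= distrC (le_lt_trans (yx j)) //.
    rewrite mxE normrM (le_lt_trans _ hd) // ler_wpM2l //.
    by rewrite (le_trans (coord_le_norm v j)) // lerDr.
  by split; [have [] := fC1 _ Uy k|rewrite distrC].
have -> : \sum_k (h *: v) 0 k * partial k f x = h * l.
  by rewrite mulr_sumr; apply: eq_bigr => k _; rewrite !mxE mulrA.
have -> : \sum_k `|(h *: v) 0 k| = `|h| * S.
  by rewrite mulr_sumr; apply: eq_bigr => k _; rewrite !mxE normrM.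
move=> H.
have -> : l - h^-1 *: (f (h *: v + x) - f x) =
    - h^-1 * (f (x + h *: v) - f x - h * l).
  by rewrite /GRing.scale /= [h *: v + x]addrC; field.
rewrite normrM normrN normfV ler_pdivrMl ?normr_gt0 //.
apply: (le_trans H); rewrite mulrCA ler_wpM2l //.
by rewrite /e' mulrAC ler_pdivrMr ?ltr_pwDl // ler_pM2l // lerDr.
Unshelve. all: by end_near.
Qed.

Lemma is_derive_on_line U f x v (t : R) :
    open U -> C1_on U f -> U (x + t *: v) ->
  is_derive t 1 (fun s : R => f (x + s *: v))
    (dotv v (gradient f (x + t *: v))).
Proof.
by move=> oU fC1 Ux; apply: is_derive_line; exact: C1_is_derive oU fC1 Ux.
Qed.

Lemma mvt_line U f x v : open U -> C1_on U f ->
    (forall t : R, 0 <= t <= 1 -> U (x + t *: v)) ->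
  exists2 c : R, 0 <= c <= 1 &
    f (x + v) - f x = dotv v (gradient f (x + c *: v)).
Proof.
move=> oU fC1 Ut.
have [c cI E] :=
  mvt_unit_interval (fun t tI => is_derive_on_line oU fC1 (Ut t tI)).
by exists c => //; rewrite -E scale1r scale0r addr0.
Qed.

Lemma is_derive_gradient_on_line U f x v (t : R) :
    open U -> C2_on U f -> U (x + t *: v) ->
  is_derive t 1 (fun s : R => dotv v (gradient f (x + s *: v)))
    (bil (hessian f (x + t *: v)) v v).
Proof.
move=> oU [_ fC2] Ux.
have d k : is_derive t 1 (fun s : R => v 0 k * partial k f (x + s *: v))
    (v 0 k * dotv v (gradient (partial k f) (x + t *: v))).
  by have := is_derive_on_line oU (fC2 k) Ux => dk; apply: is_derive_eq.
have -> : (fun s : R => dotv v (gradient f (x + s *: v))) =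
    \sum_(k < n) (fun s : R => v 0 k * partial k f (x + s *: v)).
  by apply/funext => s; rewrite fct_sumE; apply: eq_bigr => k _; rewrite mxE.
apply: is_derive_eq.
rewrite /bil exchange_big; apply: eq_bigr => k _; rewrite mulr_sumr.
by apply: eq_bigr => j _; rewrite !mxE; ring.
Qed.

Lemma taylor2_line U f x v : open U -> C2_on U f ->
    (forall t : R, 0 <= t <= 1 -> U (x + t *: v)) ->
  exists2 c : R, 0 <= c <= 1 & f (x + v) =
    f x + dotv v (gradient f x) + bil (hessian f (x + c *: v)) v v / 2.
Proof.
move=> oU fC2 Ut; have fC1 := fC2.1.
have [c cI E] := taylor2_lagrange
  (fun t tI => is_derive_on_line oU fC1 (Ut t tI))
  (fun t tI => is_derive_gradient_on_line oU fC2 (Ut t tI)).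
by exists c => //; move: E; rewrite scale1r scale0r addr0.
Qed.

(** The Hessian is frozen at x0 while the base point x varies: this uniformity
    is what allows the lower limit to run over all boundary points near xi. *)
Lemma quadratic_approx U f x0 (e : R) : open U -> C2_on U f -> U x0 -> 0 < e ->
  exists2 d : R, 0 < d & forall x v, `|x - x0| < d -> `|v| < d ->
    `|f (x + v) - f x - dotv v (gradient f x) - bil (hessian f x0) v v / 2|
      <= e * dotv v v.
Proof.
move=> oU fC2 Ux0 e0.
(* [bil_le] costs a factor n, and the Taylor remainder carries 1 / 2. *)
pose e' := 2 * e / n.+1%:R.
have e'0 : 0 < e' by rewrite divr_gt0 ?mulr_gt0.
have nU : \forall y \near x0, U y by exact: open_nbhs_nbhs.
have nH : \forall y \near x0, forall p : 'I_n * 'I_n,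
    `|hessian f x0 p.1 p.2 - hessian f y p.1 p.2| <= e'.
  apply: (@filter_forall _ _ (fun p y =>
    `|hessian f x0 p.1 p.2 - hessian f y p.1 p.2| <= e') (nbhs x0) _).
  move=> -[j k] /=.
  have [_ /cvgrPdist_le/(_ _ e'0)] := fC2.2 k _ Ux0 j.
  have hE y : hessian f y j k = partial j (partial k f) y by rewrite mxE.
  apply: (@filterS _ (nbhs x0) _) => y Hy.
  have -> : hessian f x0 j k - hessian f y j k =
      partial j (partial k f) x0 - partial j (partial k f) y.
    by congr (_ - _); exact: hE.
  exact: Hy.
have /nbhs_ballP[/= d d0 dx] : nbhs x0 (fun y => U y /\ forall p : 'I_n * 'I_n,
    `|hessian f x0 p.1 p.2 - hessian f y p.1 p.2| <= e').
  by apply: filterS2 nU nH.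
(* Both x - x0 and v are below d / 2, so the whole segment is in the ball. *)
exists (d / 2) => [|x v xd vd]; first by rewrite divr_gt0.
have near_line (t : R) : 0 <= t <= 1 -> ball x0 d (x + t *: v).
  move=> /andP[t0 t1]; rewrite -ball_normE /= distrC addrAC.
  rewrite (le_lt_trans (ler_normD _ _)) // [ltRHS]splitr ltrD //.
  rewrite normrZ ger0_norm // (le_lt_trans _ vd) // ler_piMl //.
have [c cI ->] := taylor2_line oU fC2 (fun t tI => (dx _ (near_line t tI)).1).
have [_] := dx _ (near_line c cI).
move: (hessian f x0) (hessian f (x + c *: v)) => H0 H1 Hc.
have -> : f x + dotv v (gradient f x) + bil H1 v v / 2 - f x
    - dotv v (gradient f x)
    - bil H0 v v / 2 = bil (H1 - H0) v v / 2.
  rewrite bilB; move: (bil H0 v v) (bil H1 v v) (f x) (dotv _ _) => *; ring.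
rewrite normrM [`|2^-1|]ger0_norm // ler_pdivrMr //.
apply: (@le_trans _ _ (e' * n%:R * dotv v v)).
  apply: bil_le => j k; rewrite 2!mxE [X in `|X|](_ : _ = H1 j k - H0 j k) //.
  by rewrite distrC; exact: (Hc (j, k)).
rewrite [e * _ * 2]mulrAC ler_wpM2r ?dotvv_ge0 // /e' mulrAC ler_pdivrMr //.
by rewrite [e * 2]mulrC ler_pM2l ?mulr_gt0 // ler_nat.
Qed.

(** * The sublevel set of a convex body *)

Lemma convex_set_segment F x y (t : R) : convex_set F -> F x -> F y ->
  0 <= t <= 1 -> F (x + t *: (y - x)).
Proof.
move=> cF Fx Fy /andP[t0 t1].
have := cF y x (Itv01 t0 t1); rewrite !inE => /(_ Fy Fx).
congr F; transitivity (t *: y + (1 - t) *: x) => //.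
by rewrite scalerBr scalerBl scale1r addrCA.
Qed.

Lemma cvg_gradient U f x k : C1_on U f -> U x ->
  gradient f y 0 k @[y --> x] --> gradient f x 0 k.
Proof.
move=> fC1 Ux; have [_ ck] := fC1 _ Ux k.
under eq_fun do rewrite mxE.
by rewrite mxE.
Qed.

Lemma near_dotv_gradient_gt0 U f x w : open U -> C1_on U f -> U x ->
  0 < dotv w (gradient f x) ->
  exists2 d : R, 0 < d &
    forall y, `|y - x| < d -> U y /\ 0 < dotv w (gradient f y).
Proof.
move=> oU fC1 Ux w0.
have nU : \forall y \near x, U y by exact: open_nbhs_nbhs.
have cd : dotv w (gradient f y) @[y --> x] --> dotv w (gradient f x).
  exact: (cvg_dotv (fun k => cvg_cst _)
    (fun k => @cvg_gradient _ _ _ k fC1 Ux)).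
have nd : \forall y \near x, 0 < dotv w (gradient f y) by exact: (cvgr_gt _ cd).
have /nbhs_ballP[/= d d0 dx] :
    nbhs x (fun y => U y /\ 0 < dotv w (gradient f y)).
  by apply: filterS2 nU nd.
by exists d => // y yx; apply: dx; rewrite -ball_normE /= distrC.
Qed.

(** An explicit t that works even when v = 0. *)
Lemma small_multiple v (d : R) : 0 < d ->
  exists2 t : R, 0 < t <= 1 & forall s : R, 0 <= s <= t -> `|s *: v| < d.
Proof.
move=> d0; have D0 : 0 < d + `|v| + 1 by rewrite ltr_wpDl ?addr_ge0 ?(ltW d0).
exists (d / (d + `|v| + 1)) => [|s /andP[s0 st]].
  by rewrite divr_gt0 //= ler_pdivrMr // mul1r -addrA lerDl addr_ge0.
rewrite normrZ ger0_norm //.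
rewrite (@le_lt_trans _ _ (d / (d + `|v| + 1) * `|v|)) ?ler_wpM2r //.
rewrite mulrAC ltr_pdivrMr // ltr_pM2l //.
by rewrite addrAC ltr_pwDl // ltr_wpDr // ltrDl.
Qed.

(** Otherwise f would be positive just after x on the segment from x to y,
    which lies in F. *)
Lemma dotv_gradient_le0 U F f x y : open U -> C1_on U f -> U x ->
  convex_set F -> F `<=` [set z | f z <= 0] -> F x -> F y -> f x = 0 ->
  dotv (y - x) (gradient f x) <= 0.
Proof.
move=> oU fC1 Ux cF Fsub Fx Fy fx0; rewrite leNgt; apply/negP => D0.
have [d d0 dx] := near_dotv_gradient_gt0 oU fC1 Ux D0.
have [t /andP[t0 t1] td] := small_multiple (y - x) d0.
have Fz : F (x + t *: (y - x)) by apply: convex_set_segment; rewrite ?(ltW t0).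
have near_line (s : R) : 0 <= s <= 1 -> `|(x + s *: (t *: (y - x))) - x| < d.
  move=> /andP[s0 s1]; rewrite addrAC subrr add0r scalerA; apply: td.
  by rewrite mulr_ge0 ?(ltW t0) //= ler_piMl // ltW.
have [c cI E] := mvt_line oU fC1 (fun s sI => (dx _ (near_line s sI)).1).
have [_ pos] := dx _ (near_line c cI).
have := Fsub _ Fz; rewrite /= -[f _]subr0 -[0 in X in X <= _]fx0 E dotvZl leNgt.
by rewrite mulr_gt0.
Qed.

(** For y near xi with f y < 0, the segment from y to y - t xi stays in the
    region where f decreases in the direction -xi, so f is nonzero on it and
    it avoids the boundary of F. Its intersection with F is then both open and
    closed in it. It is not empty: y - t xi is a convex combination of xi and
    of a point close to 0. *)
Lemma sublevel_subset_near U F f xi : open U -> C1_on U f -> U xi ->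
    closed F -> convex_set F -> F° 0 -> F xi ->
    0 < dotv xi (gradient f xi) ->
    (forall x, U x -> boundary F x -> f x = 0) ->
  exists2 d : R, 0 < d & forall y, `|y - xi| < d -> f y < 0 -> F y.
Proof.
move=> oU fC1 Uxi clF cF F0 Fxi D0 bdF.
have [d0 d00 d0P] := near_dotv_gradient_gt0 oU fC1 Uxi D0.
have d1 : 0 < d0 / 2 by rewrite divr_gt0.
have [t /andP[t0 t1] tP] := small_multiple xi d1.
have /nbhs_ballP[/= rho rho0 rhoP] : nbhs (0 : 'rV[R]_n) F by [].
exists (Num.min (d0 / 2) (t * rho)) => [|y].
  by rewrite lt_min d1 mulr_gt0.
rewrite lt_min => /andP[yd yrho] fy.
have in_ball (s : R) : 0 <= s <= t -> `|(y + s *: (- xi)) - xi| < d0.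
  move=> sI; rewrite addrAC (le_lt_trans (ler_normD _ _)) //.
  rewrite [ltRHS]splitr ltrD //.
  by rewrite scalerN normrN tP.
have neg (s : R) : 0 <= s <= t -> f (y + s *: (- xi)) < 0.
  move=> /andP[s0 st].
  have near_line (r : R) : 0 <= r <= 1 -> `|(y + r *: (s *: - xi)) - xi| < d0.
    move=> /andP[r0 r1]; rewrite scalerA; apply: in_ball.
    by rewrite mulr_ge0 //= (le_trans _ st) // ler_piMl.
  have [c cI E] := mvt_line oU fC1 (fun r rI => (d0P _ (near_line r rI)).1).
  have [_ pos] := d0P _ (near_line c cI).
  rewrite (le_lt_trans _ fy) // -subr_le0 E dotvZl dotvNl mulrN oppr_le0.
  by rewrite mulr_ge0 // ltW.
(* Here y - t xi = (1 - t) xi + t z with z = (y - xi) / t in the ball around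
   0. *)
have Fend : F (y + t *: (- xi)).
  have Fz : F (t^-1 *: (y - xi)).
    apply: rhoP; rewrite -ball_normE /= sub0r normrN normrZ.
    rewrite gtr0_norm ?invr_gt0 //.
    by rewrite mulrC ltr_pdivrMr // mulrC.
  have tI : 0 <= t <= 1 by rewrite ltW.
  have := convex_set_segment cF Fxi Fz tI; congr F.
  by rewrite scalerBr scalerA divff ?gt_eqF // scale1r scalerN addrA subrKC.
pose g (s : R) : 'rV[R]_n := y + s *: (- xi).
have cg : continuous g.
  by move=> s; apply: cvgD; [exact: cvg_cst|exact: scalel_continuous].
have E : `[0, t]%classic `&` g @^-1` F = `[0, t]%classic.
  apply: (@segment_connected R 0 t).
  - by exists t; split => //=; rewrite in_itv /= lexx ltW.
  - exists (g @^-1` F°).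
      by apply: open_comp => [s _|]; [exact: cg|exact: open_interior].
    apply/seteqP; split => s [sI Fs]; split; [exact: sI| |exact: sI|].
      apply: contrapT => nFs.
      have sI' : 0 <= s <= t by move: sI; rewrite /= in_itv.
      have fgs : f (g s) = 0.
        apply: bdF; first exact: (d0P _ (in_ball s sI')).1.
        by split; [exact: subset_closure|exact: nFs].
      by have := neg s sI'; rewrite -/(g s) fgs ltxx.
    exact: interior_subset Fs.
  - by exists (g @^-1` F) => //; apply: closed_comp => [s _|]; [exact: cg|].
have : `[0, t]%classic 0 by rewrite /= in_itv /= lexx ltW.
by rewrite -E => -[_]; rewrite /g /= scale0r addr0.
Qed.

(** * Height of the boundary above its tangent hyperplane *)

Lemma bil_comb M (a b : R) v w : bil M (a *: v + b *: w) (a *: v + b *: w) =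
  a ^+ 2 * bil M v v + a * b * (bil M v w + bil M w v) + b ^+ 2 * bil M w w.
Proof. by rewrite !(bilDl, bilDr, bilZl, bilZr); ring. Qed.

Lemma dotv_orthogonal_comb (a b : R) v w : dotv w v = 0 ->
  dotv (a *: v + b *: w) (a *: v + b *: w) =
  a ^+ 2 * dotv v v + b ^+ 2 * dotv w w.
Proof.
move=> wv; rewrite !(dotvDl, dotvDr, dotvZl, dotvZr) [dotv v w]dotvC wv.
by ring.
Qed.

(** The real inequality behind [height_lower], for v = a g + b w with g and w
    orthogonal, gg and ww their squared lengths, and m1, m2, m3 the
    coefficients of a^2, a b and b^2 in the shifted form. If the height -a gg
    is below L r^2 then |a| <= (L / c1) r^2, so the terms in a^2 and a b are
    O(r^3). *)
Lemma height_algebra (a b r L e K c1 c2 gg ww m1 m2 m3 : R) :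
  0 < r -> r <= 1 -> 0 < c1 -> c1 <= gg -> 0 < c2 -> c2 <= ww -> 0 < e ->
  a ^+ 2 * gg + b ^+ 2 * ww = r ^+ 2 -> a <= 0 ->
  `|m1| <= K -> `|m2| <= K -> `|m3| <= e * c2 / 2 ->
  K * (2 * (L / c1) ^+ 2 + c2^-1) * r <= e / 2 ->
  a * gg + (a ^+ 2 * m1 + a * b * m2 + b ^+ 2 * m3 + 2 * L * r ^+ 2) / 2
    <= e / 2 * r ^+ 2 ->
  (L - e) * r ^+ 2 <= - (a * gg).
Proof.
move=> r0 r1 c10 cgg c20 cww e0 norm2 a0 m1K m2K m3e rK tay.
have [|AL] := leP (L * r ^+ 2) (- (a * gg)).
  by apply: le_trans; rewrite ler_wpM2r ?sqr_ge0 // gerBl ltW.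
set C := L / c1 in rK *.
have K0 : 0 <= K := le_trans (normr_ge0 _) m1K.
have aC : - a <= C * r ^+ 2.
  rewrite /C mulrAC ler_pdivlMr //; apply: le_trans (ltW AL).
  by rewrite -mulNr ler_wpM2l // oppr_ge0.
have C2 : a ^+ 2 <= C ^+ 2 * r ^+ 4.
  rewrite -sqrrN (_ : C ^+ 2 * r ^+ 4 = (C * r ^+ 2) ^+ 2); last by ring.
  rewrite ler_pXn2r // ?nnegrE ?oppr_ge0 //.
  by apply: le_trans aC; rewrite oppr_ge0.
have b2 : b ^+ 2 <= r ^+ 2 / c2.
  rewrite ler_pdivlMr // -norm2; apply: (@le_trans _ _ (b ^+ 2 * ww)).
    by rewrite ler_wpM2l ?sqr_ge0.
  by rewrite lerDr mulr_ge0 ?sqr_ge0 // ltW // (lt_le_trans c10).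
have t1 : - (a ^+ 2 * m1) <= C ^+ 2 * r ^+ 3 * K.
  apply: (le_trans (ler_norm _)); rewrite normrN normrM ger0_norm ?sqr_ge0 //.
  apply: ler_pM => //; first exact: sqr_ge0.
  apply: (le_trans C2); rewrite ler_wpM2l ?sqr_ge0 // exprS ler_piMl //.
  by rewrite exprn_ge0 // ltW.
have t3 : - (b ^+ 2 * m3) <= r ^+ 2 * (e / 2).
  apply: (le_trans (ler_norm _)); rewrite normrN normrM ger0_norm ?sqr_ge0 //.
  have -> : r ^+ 2 * (e / 2) = r ^+ 2 / c2 * (e * c2 / 2).
    by field; rewrite gt_eqF.
  by apply: ler_pM => //; exact: sqr_ge0.
have t2 : - (a * b * m2) <= r ^+ 3 * (C ^+ 2 + c2^-1) / 2 * K.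
  apply: (le_trans (ler_norm _)); rewrite normrN normrM.
  apply: ler_pM => //.
  rewrite ler_pdivlMr //.
  have : `|a * b| * 2 * r <= r ^+ 3 * (C ^+ 2 + c2^-1) * r.
    have -> : r ^+ 3 * (C ^+ 2 + c2^-1) * r =
        C ^+ 2 * r ^+ 4 + r ^+ 2 / c2 * r ^+ 2 by ring.
    apply: (@le_trans _ _ (a ^+ 2 + b ^+ 2 * r ^+ 2)); last first.
      by apply: lerD => //; rewrite ler_wpM2r ?sqr_ge0.
    (* AM-GM with the weight r: 2 |a b| r <= a^2 + b^2 r^2. *)
    rewrite normrM -(real_normK (num_real a)) -(real_normK (num_real b)).
    have := sqr_ge0 (`|a| - `|b| * r); nra.
  by rewrite ler_pM2r.
have tot : r ^+ 2 * (K * (2 * C ^+ 2 + c2^-1) * r) <= r ^+ 2 * (e / 2).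
  by rewrite ler_wpM2l ?sqr_ge0.
have r3K : 0 <= r ^+ 3 * K by rewrite mulr_ge0 // exprn_ge0 // ltW.
have pos1 : 0 <= r ^+ 3 * K * C ^+ 2 by apply: mulr_ge0 => //; exact: sqr_ge0.
have pos2 : 0 <= r ^+ 3 * K * c2^-1 by rewrite mulr_ge0 // invr_ge0 ltW.
have E : r ^+ 2 * (K * (2 * C ^+ 2 + c2^-1) * r) =
    2 * (r ^+ 3 * K * C ^+ 2) + r ^+ 3 * K * c2^-1.
  by ring.
rewrite {}E in tot.
have E1 : C ^+ 2 * r ^+ 3 * K = r ^+ 3 * K * C ^+ 2 by ring.
have E2 : r ^+ 3 * (C ^+ 2 + c2^-1) / 2 * K =
    (r ^+ 3 * K * C ^+ 2 + r ^+ 3 * K * c2^-1) / 2 by ring.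
rewrite {}E1 in t1; rewrite {}E2 in t2.
lra.
Qed.

(** A height smaller than (L - e) r^2 would put the point at distance r on the
    segment from x to y outside the sublevel set f <= 0. *)
Lemma height_lower U F f xi u (w : 'rV[R]_n -> 'rV[R]_n) (L e : R) :
    open U -> C2_on U f -> U xi -> convex_set F -> F `<=` [set x | f x <= 0] ->
    gradient f xi != 0 -> u != 0 ->
    (forall k, w y 0 k @[y --> xi] --> u 0 k) ->
    bil (hessian f xi) u u = 2 * L * dotv u u -> 0 < e ->
  exists2 d : R, 0 < d & forall x y (r a b : R),
    `|x - xi| < d -> 0 < r < d ->
    F x -> f x = 0 -> dotv (w x) (gradient f x) = 0 ->
    F y -> y - x = a *: gradient f x + b *: w x -> r <= enorm (y - x) ->
    (L - e) * r ^+ 2 <= dotv (x - y) (gradient f x).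
Proof.
move=> oU fC2 Uxi cF Fsub G0 u0 wu HL e0; have fC1 := fC2.1.
have cg k : gradient f y 0 k @[y --> xi] --> gradient f xi 0 k.
  exact: cvg_gradient fC1 Uxi.
set G := gradient f xi in G0 cg *.
pose M := hessian f xi - (2 * L)%:M.
have bilM v := bil_shift (hessian f xi) (2 * L) v; rewrite -/M in bilM.
have Mu : bil M u u = 0 by rewrite /M bilB bil_scalar HL subrr.
pose c1 := dotv G G / 2; pose c2 := dotv u u / 2.
have c10 : 0 < c1 by rewrite divr_gt0 ?dotvv_gt0.
have c20 : 0 < c2 by rewrite divr_gt0 ?dotvv_gt0.
pose K := `|bil M G G| + `|bil M G u + bil M u G| + 1.
have ngg : \forall y \near xi, c1 <= dotv (gradient f y) (gradient f y).
  apply: (cvgr_ge (dotv G G) (cvg_dotv cg cg)).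
  by rewrite gtr_pMr ?dotvv_gt0 // invf_lt1 ?ltr1n.
have nww : \forall y \near xi, c2 <= dotv (w y) (w y).
  apply: (cvgr_ge (dotv u u) (cvg_dotv wu wu)).
  by rewrite gtr_pMr ?dotvv_gt0 // invf_lt1 ?ltr1n.
have nm1 : \forall y \near xi, `|bil M (gradient f y) (gradient f y)| <= K.
  apply: (cvgr_norm_le (bil M G G) (cvg_bil (M := M) cg cg) K).
  by rewrite /K -addrA ltrDl ltr_wpDl.
have nm2 : \forall y \near xi,
    `|bil M (gradient f y) (w y) + bil M (w y) (gradient f y)| <= K.
  apply: (cvgr_norm_le (bil M G u + bil M u G)
    (cvgD (cvg_bil (M := M) cg wu) (cvg_bil (M := M) wu cg)) K).
  by rewrite /K addrAC ltrDr ltr_wpDl.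
have nm3 : \forall y \near xi, `|bil M (w y) (w y)| <= e * c2 / 2.
  apply: (cvgr_norm_le (bil M u u) (cvg_bil (M := M) wu wu) (e * c2 / 2)).
  by rewrite Mu normr0 divr_gt0 // mulr_gt0.
have nU : \forall y \near xi, U y by exact: open_nbhs_nbhs.
have /nbhs_ballP[/= d1 d10 d1P] : nbhs xi (fun y => (U y /\
    c1 <= dotv (gradient f y) (gradient f y) /\
    c2 <= dotv (w y) (w y)) /\
    `|bil M (gradient f y) (gradient f y)| <= K /\
    `|bil M (gradient f y) (w y) + bil M (w y) (gradient f y)| <= K /\
    `|bil M (w y) (w y)| <= e * c2 / 2).
  by apply: filterI; apply: filterI => //; apply: filterI.
have e2 : 0 < e / 2 by rewrite divr_gt0.
have [d2 d20 d2P] := quadratic_approx oU fC2 Uxi e2.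
pose KK := K * (2 * (L / c1) ^+ 2 + c2^-1).
have KK0 : 0 <= KK.
  apply: mulr_ge0; first by rewrite /K !addr_ge0.
  apply: addr_ge0; last by rewrite invr_ge0 ltW.
  by apply: mulr_ge0 => //; exact: sqr_ge0.
pose d3 := e / 2 / (KK + 1).
have d30 : 0 < d3 by rewrite divr_gt0 // ltr_wpDl.
exists (Num.min (Num.min d1 d2) (Num.min 1 d3)) => [|x y r a b].
  by rewrite !lt_min d10 d20 d30 ltr01.
rewrite !lt_min => /andP[/andP[xd1 xd2] _].
move=> /andP[r0 /andP[/andP[_ rd2] /andP[r1 rd3]]].
move=> Fx fx0 wx Fy yE ry.
have /d1P[[Ux [gg ww]] [m1 [m2 m3]]] : ball xi d1 x.
  by rewrite -ball_normE /= distrC.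
have D0 := dotv_gradient_le0 oU fC1 Ux cF Fsub Fx Fy fx0.
set N := enorm (y - x) in ry.
have N0 : 0 < N by exact: lt_le_trans ry.
pose s := r / N.
have s0 : 0 < s by rewrite divr_gt0.
have s1 : s <= 1 by rewrite ler_pdivrMr // mul1r.
(* Rescale to distance exactly r; the height can only decrease. *)
pose v := s *: (y - x).
have vE : v = (s * a) *: gradient f x + (s * b) *: w x.
  by rewrite /v yE scalerDr !scalerA.
have vv : dotv v v = r ^+ 2.
  rewrite /v dotvZl dotvZr mulrA -expr2 -sqr_enorm -exprMn /s -/N divfK //.
  by rewrite gt_eqF.
have Fv : F (x + v) by apply: convex_set_segment; rewrite // (ltW s0).
have vd : `|v| < d2.
  apply: (le_lt_trans (norm_le_enorm v)).
  by rewrite /enorm vv sqrtr_sqr ger0_norm // ltW.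
have dv : dotv v (gradient f x) = s * a * dotv (gradient f x) (gradient f x).
  by rewrite vE dotvDl !dotvZl wx mulr0 addr0.
have sa0 : s * a <= 0.
  have : dotv v (gradient f x) <= 0 by rewrite dotvZl pmulr_rle0.
  by rewrite dv pmulr_lle0 // (lt_le_trans c10).
have := d2P x v xd2 vd; rewrite fx0 subr0 bilM vv.
move=> /ler_normlP[+ _].
have := Fsub _ Fv; rewrite /= dv => fv tay.
have key : (L - e) * r ^+ 2 <= - (s * a * dotv (gradient f x) (gradient f x)).
  apply: (height_algebra r0 (ltW r1) c10 gg c20 ww e0
    (b := s * b) _ sa0 m1 m2 m3).
  - by rewrite -vv vE (dotv_orthogonal_comb _ _ wx).
  - have rd3' := ltW rd3.
    apply: (le_trans (ler_wpM2l KK0 rd3')).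
    rewrite /d3 mulrCA ler_piMr ?(ltW e2) // ler_pdivrMr ?ltr_wpDl //.
    by rewrite mul1r lerDl.
  - have Bv := bil_comb M (s * a) (s * b) (gradient f x) (w x).
    rewrite -vE in Bv.
    move: tay; rewrite Bv; lra.
apply: (le_trans key).
have -> : dotv (x - y) (gradient f x) = - dotv (y - x) (gradient f x).
  by rewrite -dotvNl opprB.
by rewrite -dv dotvZl lerN2 ler_niMl.
Qed.

(** The witness has tangential part of length r and normal part of order r^2,
    tuned so that the height is (L + e) r^2; the surplus e r^2 absorbs the
    Taylor error and makes f negative. *)
Lemma height_upper U f F xi u (L e d0 : R) :
    open U -> C2_on U f -> U xi -> 0 < d0 ->
    (forall y, `|y - xi| < d0 -> f y < 0 -> F y) ->
    gradient f xi != 0 -> u != 0 -> dotv u (gradient f xi) = 0 -> f xi = 0 ->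
    bil (hessian f xi) u u = 2 * L * dotv u u -> 0 < e ->
  exists2 d : R, 0 < d & forall r : R, 0 < r < d -> exists a b : R,
    let y := xi + (a *: gradient f xi + b *: u) in
    [/\ F y, r <= enorm (xi - y) &
      dotv (xi - y) (gradient f xi) = (L + e) * r ^+ 2].
Proof.
move=> oU fC2 Uxi d00 Fnear G0 u0 uG fxi0 HL e0.
set G := gradient f xi in G0 uG *.
pose M := hessian f xi - (2 * L)%:M.
have bilM v := bil_shift (hessian f xi) (2 * L) v; rewrite -/M in bilM.
have Mu : bil M u u = 0 by rewrite /M bilB bil_scalar HL subrr.
pose GG := dotv G G; have GG0 : 0 < GG by exact: dotvv_gt0.
pose N := enorm u; have N0 : 0 < N by exact: enorm_gt0.
pose c := (L + e) / GG.
pose m1 := bil M G G; pose m2 := bil M G u + bil M u G.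
have C0 : 0 < 1 + c ^+ 2 * GG.
  by rewrite ltr_pwDl // mulr_ge0 ?(ltW GG0) // sqr_ge0.
pose e1 := e / 4 / (1 + c ^+ 2 * GG).
have e10 : 0 < e1 by rewrite !divr_gt0.
have [d1 d10 d1P] := quadratic_approx oU fC2 Uxi e10.
pose K1 := `|c * m2 / (2 * N)| + `|c ^+ 2 * m1 / 2 + L * c ^+ 2 * GG|.
have K10 : 0 <= K1 by rewrite addr_ge0.
pose B := `|c| * `|G| + `|u| / N.
have B0 : 0 <= B by rewrite addr_ge0 ?mulr_ge0 ?invr_ge0 ?(ltW N0).
pose d2 := Num.min d0 d1 / (B + 1).
have d20 : 0 < d2 by rewrite divr_gt0 ?ltr_wpDl // lt_min d00.
pose d3 := e / 4 / (K1 + 1).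
have d30 : 0 < d3 by rewrite !divr_gt0 ?ltr_wpDl.
exists (Num.min 1 (Num.min d2 d3)) => [|r]; first by rewrite !lt_min ltr01 d20.
rewrite !lt_min => /andP[r0 /andP[r1 /andP[rd2 rd3]]].
exists (- (c * r ^+ 2)), (r / N); set v := (X in xi + X) => y.
have xy : xi - y = - v by rewrite /y opprD addrA subrr add0r.
have vG : dotv v G = - ((L + e) * r ^+ 2).
  rewrite dotvDl !dotvZl uG mulr0 addr0 -/GG /c.
  by field; rewrite gt_eqF.
have vv : dotv v v = r ^+ 2 * (1 + c ^+ 2 * GG * r ^+ 2).
  rewrite (dotv_orthogonal_comb _ _ uG) -[dotv u u]sqr_enorm -/N -/GG.
  by field; rewrite gt_eqF.
have r21 : r ^+ 2 <= 1 by rewrite expr_le1 // ltW.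
have vB : `|v| <= r * B.
  apply: (le_trans (ler_normD _ _)); rewrite !normrZ normrN.
  have iN0 : 0 < N^-1 by rewrite invr_gt0.
  rewrite (normrM c) (ger0_norm (sqr_ge0 r)) (gtr0_norm r0) (gtr0_norm iN0).
  rewrite mulrDr; apply: lerD; last by rewrite mulrAC mulrA.
  rewrite mulrAC mulrC ler_wpM2r ?mulr_ge0 // expr2 ler_piMl ?(ltW r0) //.
  exact: ltW.
have : `|v| < Num.min d0 d1.
  apply: (le_lt_trans vB); move: rd2; rewrite ltr_pdivlMr ?ltr_wpDl //.
  apply: le_lt_trans; rewrite ler_wpM2l ?(ltW r0) //.
  by rewrite lerDl.
rewrite lt_min => /andP[vd0 vd1].
have fy : f y < 0.
  have : `|xi - xi| < d1 by rewrite subrr normr0.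
  move=> /d1P/(_ vd1); rewrite -/G fxi0 subr0 bilM vG => /ler_normlP[_].
  rewrite -/y.
  have -> : bil M v v = r ^+ 2 *
      (r * (- (2 * (c * m2 / (2 * N))) + r * (2 * (c ^+ 2 * m1 / 2)))).
    rewrite bil_comb Mu -/m1 -/m2.
    by field; rewrite gt_eqF.
  have : e1 * dotv v v <= r ^+ 2 * (e / 4).
    have -> : r ^+ 2 * (e / 4) = e1 * (r ^+ 2 * (1 + c ^+ 2 * GG)).
      by rewrite /e1; field; rewrite gt_eqF.
    rewrite vv ler_wpM2l ?(ltW e10) // ler_wpM2l ?sqr_ge0 // lerD2l.
    by rewrite ler_piMr // mulr_ge0 ?(ltW GG0) // sqr_ge0.
  rewrite vv.
  have : r ^+ 2 * (r * (- (c * m2 / (2 * N)) +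
        r * (c ^+ 2 * m1 / 2 + L * c ^+ 2 * GG)))
      <= r ^+ 2 * (e / 4).
    rewrite ler_wpM2l ?sqr_ge0 //; apply: (@le_trans _ _ (r * K1)).
      rewrite ler_wpM2l ?(ltW r0) // /K1 lerD //.
        by rewrite (le_trans (ler_norm _)) // normrN.
      rewrite (le_trans (ler_norm _)) // normrM gtr0_norm //.
      by rewrite ler_piMl // ltW.
    move: rd3; rewrite /d3 ltr_pdivlMr ?ltr_wpDl // => /ltW; apply: le_trans.
    by rewrite ler_wpM2l ?(ltW r0) // lerDl.
  have : 0 < r ^+ 2 * e by rewrite mulr_gt0 // exprn_gt0.
  move: (c * m2 / (2 * N)) (c ^+ 2 * m1 / 2) => t1 t2.
  nra.
split; first by apply: Fnear => //; rewrite /y addrAC subrr add0r.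
- rewrite xy enormN /enorm vv -[leLHS]gtr0_norm // -sqrtr_sqr ler_wsqrtr //.
  rewrite ler_peMr ?sqr_ge0 // lerDl mulr_ge0 ?sqr_ge0 //.
  by rewrite mulr_ge0 ?(ltW GG0) // sqr_ge0.
- by rewrite xy dotvNl vG opprK.
Qed.

(** * The tangent field and the lower limit *)

Lemma tangent_field_orthogonal f (i : 'I_n) (alpha : 'I_n -> R) x :
  partial i f x != 0 -> dotv (tangent_field f i alpha x) (gradient f x) = 0.
Proof.
move=> fi0; rewrite /tangent_field.
have tv j : j != i -> dotv (tangent_vec f i j x) (gradient f x) = 0.
  move=> ji; rewrite /dotv (bigD1 j) //= (bigD1 i) 1?eq_sym //=.
  rewrite big1 ?addr0 => [|k /andP[kj ki]].
    rewrite !mxE !eqxx eq_sym (negbTE ji) mul1r mulNr divfK //.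
    by rewrite subrr.
  by rewrite mxE (negbTE kj) (negbTE ki) mul0r.
elim/big_rec: _ => [|j v ji IH].
  by rewrite -(scale0r (gradient f x)) dotvZl mul0r.
by rewrite dotvDl dotvZl tv // mulr0 add0r.
Qed.

Lemma cvg_tangent_field U f xi (i k : 'I_n) (alpha : 'I_n -> R) :
  C1_on U f -> U xi -> partial i f xi != 0 ->
  tangent_field f i alpha y 0 k @[y --> xi] --> tangent_field f i alpha xi 0 k.
Proof.
move=> fC1 Uxi fi0.
have cp j : partial j f y @[y --> xi] --> partial j f xi.
  by have [_] := fC1 _ Uxi j.
have E y : tangent_field f i alpha y 0 k = \sum_(j < n | j != i) alpha j *
    (if k == j then 1
     else if k == i then - (partial j f y / partial i f y) else 0).
  rewrite summxE; apply: eq_bigr => j _.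
  by rewrite mxE; congr (_ * _); exact: mxE.
have -> : (fun y => tangent_field f i alpha y 0 k) = _ := funext E.
rewrite (E xi).
apply: (@cvg_big _ _ _ _ _ add_continuous _ (nbhs xi)) => j _.
apply: (@cvgM _ _ (nbhs xi)); first exact: cvg_cst.
case: (k == j); first exact: cvg_cst.
case: (k == i); last exact: cvg_cst.
apply: (@cvgN _ _ _ (nbhs xi)); apply: (@cvgM _ _ (nbhs xi)) => //.
exact: cvgV.
Qed.

(** Both bounds, for any field w through u at xi: its continuity carries the
    vanishing of the shifted form at u over to nearby points, and its tangency
    makes the two spanning vectors of the plane orthogonal. *)
Lemma gammahatE U f F xi u (w : 'rV[R]_n -> 'rV[R]_n) (L : R) :
    open U -> C2_on U f -> U xi -> closed F -> convex_set F -> F° 0 ->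
    boundary F xi -> F `<=` [set x | f x <= 0] -> 0 < dotv xi (gradient f xi) ->
    (forall x, U x -> boundary F x -> f x = 0) ->
    u != 0 -> w xi = u ->
    (forall k, w y 0 k @[y --> xi] --> u 0 k) ->
    (\forall y \near xi, dotv (w y) (gradient f y) = 0) ->
    bil (hessian f xi) u u = 2 * L * dotv u u ->
  gammahat F f xi w = (L / dotv xi (gradient f xi))%:E.
Proof.
move=> oU fC2 Uxi clF cF F0 bxi Fsub D0 bdF u0 wxi wu ntan HL.
have fC1 := fC2.1.
have bdsub x : boundary F x -> F x.
  by move=> [+ _]; rewrite -(closure_id F).1.
have G0 := dotv_gt0_neq0 D0.
set D := dotv xi (gradient f xi) in D0 *.
rewrite /gammahat limf_einfE; apply/eqP; rewrite eq_le; apply/andP; split.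
- apply: ub_ereal_sup => _ [V FV <-].
  apply/lee_addgt0Pr => e e0.
  have eD0 : 0 < e * D by rewrite mulr_gt0.
  have [d0 d00 d0P] :=
    sublevel_subset_near oU fC1 Uxi clF cF F0 (bdsub _ bxi) D0 bdF.
  have [d dpos dP] := height_upper oU fC2 Uxi d00 d0P G0 u0
    (etrans (congr1 (fun z => dotv z _) (esym wxi)) (nbhs_singleton ntan))
    (bdF _ Uxi bxi) HL eD0.
  case: FV => -[P Q] /= [P0 Qxi] PQ.
  have [r [Pr /andP[r0 rd]]] : exists r : R, P r /\ 0 < r < d.
    near (0 : R)^'+ => r; exists r; split; first by near: r.
    by apply/andP; split; near: r; [exact: nbhs_right_gt|exact: nbhs_right_lt].
  have Vr : V (r, xi).
    by apply: PQ; split => //=; exact: (nbhs_singleton Qxi).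
  apply: (@le_trans _ _ (chat F f r xi (w xi) / (r ^+ 2)%:E)%E).
    by apply: ereal_inf_lbound; exists (r, xi).
  have rI : 0 < r < d by rewrite r0.
  have [a [b [Fy ry yh]]] := dP r rI.
  rewrite inver gt_eqF ?exprn_gt0 // lee_pdivrMr ?exprn_gt0 // -EFinD -EFinM.
  apply: ereal_inf_lbound; exists (xi + (a *: gradient f xi + b *: u)).
    by split => //; split => //; exists a, b; rewrite wxi.
  congr EFin; rewrite /dual_pt dotvZr yh -/D.
  by field; rewrite gt_eqF.
- apply/lee_subgt0Pr => e e0.
  have eD0 : 0 < e * D / 2 by rewrite divr_gt0 // mulr_gt0.
  have [d dpos dP] := height_lower oU fC2 Uxi cF Fsub G0 u0 wu HL eD0.
  have cD : dotv y (gradient f y) @[y --> xi] --> D.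
    apply: (@cvg_dotv _ (nbhs xi) _) => k; first exact: coord_continuous.
    exact: cvg_gradient fC1 Uxi.
  have nD : \forall y \near xi, 0 < dotv y (gradient f y).
    exact: (cvgr_gt D cD).
  (* At xi the left side is L - e D, so half of the margin e D is left for the
     variation of the denominator <y, grad f y>. *)
  have nL : \forall y \near xi,
      (L / D - e) * dotv y (gradient f y) <= L - e * D / 2.
    have cL :
        (L / D - e) * dotv y (gradient f y) @[y --> xi] --> (L / D - e) * D.
      by apply: (@cvgM _ _ (nbhs xi)) => //; exact: cvg_cst.
    apply: (cvgr_le ((L / D - e) * D) cL).
    rewrite mulrBl divfK ?gt_eqF //; lra.
  have nU : \forall y \near xi, U y by exact: open_nbhs_nbhs.
  have nd : \forall y \near xi, `|y - xi| < d.
    by apply/nbhs_ballP; exists d => //= y; rewrite -ball_normE /= distrC.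
  pose good := [set x | U x /\ `|x - xi| < d] `&`
    [set x | dotv (w x) (gradient f x) = 0 /\ 0 < dotv x (gradient f x) /\
             (L / D - e) * dotv x (gradient f x) <= L - e * D / 2].
  have ngood : nbhs xi good.
    by apply: filterI; apply: filterI => //; apply: filterI.
  pose q (p : R * 'rV[R]_n) := (chat F f p.1 p.2 (w p.2) / (p.1 ^+ 2)%:E)%E.
  pose V := [set p | ((L / D)%:E - e%:E <= q p)%E].
  apply: le_ereal_sup_tmp; exists (ereal_inf (q @` V)); last first.
    by apply: le_ereal_inf_tmp => _ [p Vp <-].
  exists V => //.
  exists ([set r | 0 < r < d], boundary F `&` good) => /=.
    split; last by apply: (@filterS _ (nbhs xi)) ngood => x Qx bx; split.
    near=> r; apply/andP; split; near: r.
      exact: nbhs_right_gt.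
    exact: nbhs_right_lt.
  move=> [r x] /= [rI [bx [[Ux xd] [wx0 [Dx DL]]]]].
  have /andP[r0 rd] := rI.
  rewrite /V /q /= inver gt_eqF ?exprn_gt0 // lee_pdivlMr ?exprn_gt0 //.
  rewrite -EFinB -EFinM.
  apply: le_ereal_inf_tmp => _ [y [[Fy [a [b yE]]] ry] <-].
  rewrite lee_fin /dual_pt dotvZr [leRHS]mulrC ler_pdivlMr //.
  rewrite mulrAC.
  have := dP x y r a b xd rI (bdsub _ bx) (bdF _ Ux bx) wx0 Fy.
  rewrite {1}yE addrAC subrr add0r => /(_ erefl).
  rewrite -enormN opprB => /(_ ry); apply: le_trans.
  by rewrite ler_wpM2r ?sqr_ge0.
Unshelve. all: by end_near.
Qed.

End euclidean.

Theorem corollary2 (R : realType) (n : nat) (hn : (2 <= n)%N)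
    (F : set 'rV[R]_n) (xi : 'rV[R]_n)
    (Fcompact : compact F) (Fconvex : convex_set F) (F0 : F° 0)
    (xibd : boundary F xi)
    (delta : R) (delta0 : 0 < delta) (f : 'rV[R]_n -> R)
    (fC2 : C2_on (eball xi delta) f)
    (Fsub : F `<=` [set x | f x <= 0])
    (fxi : 0 < dotv xi (gradient f xi))
    (bdF : forall x, eball xi delta x -> (boundary F x <-> f x = 0))
    (i : 'I_n) (hi : first_nonzero_partial f xi i)
    (u : 'rV[R]_n) (Tu : tangent_space f xi u) (u0 : u != 0)
    (alpha : 'I_n -> R) (ualpha : u = tangent_field f i alpha xi) :
  kappahat F f xi (tangent_field f i alpha) =
  (1 / (2 * enorm (gradient f xi) * enorm u ^+ 2)
   * dotv (hessian f xi *m u^T)^T u)%:E.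
Proof.
have oU := @eball_open R n xi delta delta0.
have Uxi : eball xi delta xi.
  by rewrite /eball /= subrr /enorm -(scale0r xi) dotvZl mul0r sqrtr0.
have [fi0 _] := hi; have fC1 := fC2.1.
have uu0 : 0 < dotv u u by exact: dotvv_gt0.
have GN0 := enorm_gt0 (dotv_gt0_neq0 fxi).
have clF : closed F by apply: compact_closed.
have ntan : \forall y \near xi,
    dotv (tangent_field f i alpha y) (gradient f y) = 0.
  have [_ ci] := fC1 _ Uxi i.
  have : \forall y \near xi, partial i f y != 0 by exact: (cvgr_neq0 _ ci).
  apply: (@filterS _ (nbhs xi)) => y; exact: tangent_field_orthogonal.
pose L := bil (hessian f xi) u u / (2 * dotv u u).
have HL : bil (hessian f xi) u u = 2 * L * dotv u u.
  by rewrite /L; field; rewrite gt_eqF.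
rewrite /kappahat.
rewrite (gammahatE oU fC2 Uxi clF Fconvex F0 xibd Fsub fxi _ u0
  (esym ualpha) _ ntan HL).
- rewrite -EFinM dotv_bil; congr EFin.
  rewrite /dual_pt enormZ gtr0_norm ?invr_gt0 // sqr_enorm /L.
  by field; rewrite !gt_eqF.
- by move=> x Ux /(bdF _ Ux).
- by move=> k; rewrite ualpha; exact: cvg_tangent_field fC1 Uxi fi0.
Qed.
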